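(* Let $a\le x<x'\le b$ be real numbers, $0<\alpha\le\frac12$, $y=(1-\alpha)x+\alpha x'$, $y'=\alpha x+(1-\alpha)x'$, and let $m'=\frac12$ if $y\neq y'$ and $m'=0$ if $y=y'$. Let $f:[a,b]\to\mathbb{R}$ be convex and let $p:[x,x']\to[0,\infty)$ be integrable and symmetric about $\frac{x+x'}{2}$. Let $G_1,G_2,\mathrm{Ip}_1,\mathrm{Ip}_2,\mathrm{Sp}:[0,1]\to\mathbb{R}$ be the functions defined in the context. Then: (1) $\mathrm{Sp}$ is convex on $[0,1]$. (2) For all $t\in[0,1]$: $$\begin{aligned}[G_1(t)+G_2(t)]\int_x^{x'}p(s)\,ds&\le \mathrm{Sp}(t)\\&\le(1-t)\int_x^{x'}\left[f((1-\alpha)x+\alpha s)+f((1-\alpha)x'+\alpha s)\right]p(s)\,ds+t[f(x)+f(x')]\int_x^{x'}p(s)\,ds\\&\le[f(x)+f(x')]\int_x^{x'}p(s)\,ds\end{aligned}$$ and $$\frac{\mathrm{Ip}_1(1-t)+\mathrm{Ip}_2(1-t)}{2}\le \mathrm{Sp}(t).$$ (3) $$\frac{\mathrm{Ip}_1(t)+\mathrm{Ip}_2(t)+\mathrm{Ip}_1(1-t)+\mathrm{Ip}_2(1-t)}{4}\le \mathrm{Sp}(t)\qquad(t\in[m',1])$$ and $$\sup_{t\in[0,1]}\mathrm{Sp}(t)=[f(x)+f(x')]\int_x^{x'}p(s)\,ds.$$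
   Context: Symmetric about $\frac{x+x'}{2}$ means $p(s)=p(x+x'-s)$ for $s\in[x,x']$. For $t\in[0,1]$ define $$G_1(t)=\frac12\left[f(tx+(1-t)y)+f(tx'+(1-t)y')\right],\qquad G_2(t)=\frac12\left[f(tx+(1-t)y')+f(tx'+(1-t)y)\right],$$ $$\mathrm{Ip}_1(t)=\int_x^{x'}\left[f\big(t((1-\alpha)x+\alpha s)+(1-t)y\big)+f\big(t((1-\alpha)x'+\alpha s)+(1-t)y'\big)\right]p(s)\,ds,$$ $$\mathrm{Ip}_2(t)=\int_x^{x'}\left[f\big(t((1-\alpha)x+\alpha s)+(1-t)y'\big)+f\big(t((1-\alpha)x'+\alpha s)+(1-t)y\big)\right]p(s)\,ds,$$ $$\begin{aligned}\mathrm{Sp}(t)=\int_x^{x'}\frac12\Big[&f\big(tx+(1-t)((1-\alpha)x+\alpha s)\big)+f\big(tx+(1-t)((1-\alpha)x'+\alpha s)\big)\\&+f\big(tx'+(1-t)((1-\alpha)x+\alpha s)\big)+f\big(tx'+(1-t)((1-\alpha)x'+\alpha s)\big)\Big]p(s)\,ds.\end{aligned}$$ *)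

(* Defs.v *)
From HB Require Import structures.
From mathcomp Require Import all_boot all_order all_algebra.
From mathcomp Require Import all_classical all_reals all_analysis.

Set Implicit Arguments.
Unset Strict Implicit.
Unset Printing Implicit Defensive.

Import Order.TTheory GRing.Theory Num.Theory.
Import numFieldNormedType.Exports.

Local Open Scope classical_set_scope.
Local Open Scope ring_scope.

(* Functions on [a, b], [x, x'] or [0, 1] are represented by total functions
   R -> R whose values outside the interval are irrelevant. Integrals are taken
   for the completed Lebesgue measure (its sigma-algebra consists of the
   Lebesgue-measurable sets, not only of the Borel sets), so that "integrable"
   means Lebesgue integrable. *)

Definition itv_integrable (R : realType) (u v : R) (g : R -> R) : Prop :=
  (@completed_lebesgue_measure R).-integrable `[u, v] (EFin \o g).

Definition itv_integral (R : realType) (u v : R) (g : R -> R) : R :=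
  \int[@completed_lebesgue_measure R]_(s in `[u, v]) g s.

Definition G1 (R : realType) (f : R -> R) (x x' y y' t : R) : R :=
  2^-1 * (f (t * x + (1 - t) * y) + f (t * x' + (1 - t) * y')).

Definition G2 (R : realType) (f : R -> R) (x x' y y' t : R) : R :=
  2^-1 * (f (t * x + (1 - t) * y') + f (t * x' + (1 - t) * y)).

Definition Ip1 (R : realType) (f p : R -> R) (alpha x x' y y' t : R) : R :=
  itv_integral x x' (fun s =>
    (f (t * ((1 - alpha) * x + alpha * s) + (1 - t) * y)
     + f (t * ((1 - alpha) * x' + alpha * s) + (1 - t) * y')) * p s).

Definition Ip2 (R : realType) (f p : R -> R) (alpha x x' y y' t : R) : R :=
  itv_integral x x' (fun s =>
    (f (t * ((1 - alpha) * x + alpha * s) + (1 - t) * y')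
     + f (t * ((1 - alpha) * x' + alpha * s) + (1 - t) * y)) * p s).

Definition Sp (R : realType) (f p : R -> R) (alpha x x' t : R) : R :=
  itv_integral x x' (fun s =>
    2^-1 * (f (t * x + (1 - t) * ((1 - alpha) * x + alpha * s))
            + f (t * x + (1 - t) * ((1 - alpha) * x' + alpha * s))
            + f (t * x' + (1 - t) * ((1 - alpha) * x + alpha * s))
            + f (t * x' + (1 - t) * ((1 - alpha) * x' + alpha * s))) * p s).

(* Main.v *)
Require Import Defs.
From HB Require Import structures.
From mathcomp Require Import all_boot all_order all_algebra.
From mathcomp Require Import all_classical all_reals all_analysis.
From mathcomp Require Import measurable_realfun lra ring.

Set Implicit Arguments.
Unset Strict Implicit.
Unset Printing Implicit Defensive.

Import Order.TTheory GRing.Theory Num.Theory.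
Import numFieldNormedType.Exports.

Local Open Scope classical_set_scope.
Local Open Scope ring_scope.

(* With c = x + x', u(s) = (1 - alpha) x + alpha s and
   v(s) = (1 - alpha) x' + alpha s one has v(c - s) = c - u(s). By the symmetry
   of p, the integral of (phi(u) + phi(v)) p therefore equals that of
   (phi(u) + phi(c - u)) p for every convex phi, where x <= u <= y. Hence such
   integrals can be compared through the pointwise sums phi(w) + phi(c - w) for
   w in [x, y]. All quantities in the theorem have this form, and the pointwise
   comparisons follow from the fact that phi(z) + phi(c - z) decreases as z moves
   from an endpoint towards c / 2. For part (3), move one argument of
   f(t a + (1 - t) b) at a time, (a, b) ranging successively over
   {u, c - u} x {y, y'} -> {u, c - u} x {u, c - u} -> {x, x'} x {u, c - u}. *)

(** * Reflection invariance of the completed Lebesgue measure *)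

(* A cover by intervals ]a, b] is reflected to one by [c - b, c - a[. *)
Lemma mu_ext_reflect_le (R : realType) (c : R) (X : set R) :
  ((@wlength R idfun)^* ((fun s : R => (c - s)%R) @^-1` X)
    <= (@wlength R idfun)^* X)%mu%E.
Proof.
apply: le_ereal_inf_tmp => _ [A [mA XA] <-].
set r := (fun s : R => c - s).
have rXA : r @^-1` X `<=` \bigcup_k (r @^-1` A k) by move=> s /XA [k _ Ak]; exists k.
apply: (le_trans (le_outer_measure (@wlength R idfun)^*%mu _ _ rXA)).
apply: (le_trans (outer_measure_sigma_subadditive (@wlength R idfun)^*%mu _)).
apply: lee_nneseries => [k _ _|k _]; first exact: mu_ext_ge0.
have /ocitvP[->|[[a b]/= ab ->]] := mA k.
  by rewrite preimage_set0 outer_measure0.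
have -> : r @^-1` `]a, b]%classic = `[c - b, c - a[%classic.
  by apply/seteqP; split=> s; rewrite /r/= !in_itv/= => /andP[? ?]; apply/andP; lra.
(* The reflected interval is closed on the left, so [wlength] does not give its outer measure
   directly. The Lebesgue measure of an interval does, since it unfolds to this outer measure. *)
have := lebesgue_measure_itv `[c - b, c - a[.
rewrite /lebesgue_measure /lebesgue_stieltjes_measure /measure_extension => ->.
rewrite wlength_itv/= !lte_fin ab ltrD2l ltrN2 ab.
by rewrite -!EFinB lee_fin; lra.
Qed.

(** The reflection is an involution, so the inequality applied to the reflected set is the converse
    inequality. *)
Lemma mu_ext_reflect (R : realType) (c : R) (X : set R) :
  ((@wlength R idfun)^* ((fun s : R => (c - s)%R) @^-1` X)
    = (@wlength R idfun)^* X)%mu%E.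
Proof.
apply/eqP; rewrite eq_le mu_ext_reflect_le/=.
apply: le_trans (mu_ext_reflect_le c _).
by rewrite -comp_preimage (_ : _ \o _ = id)//; apply/funext => s /=; rewrite subKr.
Qed.

(** Carathéodory's criterion for the preimage of [A], tested on [X], is the criterion for [A] tested
    on the reflection of [X], because reflection preserves the outer measure. *)
Lemma completed_lebesgue_reflect_measurable (R : realType) (c : R) :
  measurable_fun [set: caratheodory_type (@wlength R idfun)^*%mu]
    ((fun s => c - s) : _ -> caratheodory_type (@wlength R idfun)^*%mu).
Proof.
move=> _ A mA; rewrite setTI.
suff : caratheodory_measurable (@wlength R idfun)^*%mu ((fun s : R => c - s) @^-1` A).
  by [].
move=> X; set r := (fun s : R => c - s).
have rr Y : r @^-1` (r @^-1` Y) = Y.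
  by apply/seteqP; split=> s; rewrite /r/= subKr.
rewrite -[LHS](mu_ext_reflect c) -[X in X + _](mu_ext_reflect c).
rewrite -[X in _ + X](mu_ext_reflect c) -/r.
rewrite !preimage_setI preimage_setC !rr.
exact: (mA (r @^-1` X)).
Qed.

(** Change of variables through the pushforward: the reflection about (u + v) / 2 maps the measure
    to itself and [u, v] onto itself. *)
Lemma integral_reflect (R : realType) (u v : R) (g : R -> R) :
  itv_integrable u v g -> itv_integrable u v (fun s => g (u + v - s)) ->
  itv_integral u v g = itv_integral u v (fun s => g (u + v - s)).
Proof.
set T := caratheodory_type (@wlength R idfun)^*%mu.
set mu := @completed_lebesgue_measure R.
move=> ig irg; rewrite /itv_integral /Rintegral; congr fine.
pose r : T -> T := fun s => u + v - s.
have mr : measurable_fun [set: T] r by exact: completed_lebesgue_reflect_measurable.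
pose D : set T := `[u, v]%classic.
have mD : measurable D by apply: sub_caratheodory; exact: measurable_itv.
have rD : r @^-1` D = D.
  by apply/seteqP; split=> s; rewrite /r/D/= !in_itv/= => /andP[? ?]; apply/andP; lra.
(* Extending [g] by 0 outside [D] makes it measurable on the whole space, as the pushforward formula
   requires. *)
pose h := (EFin \o g) \_ D : T -> \bar R.
transitivity (\int[mu]_(s in D) h s)%E.
  by apply: eq_integral => s sD; rewrite /h patchE sD.
transitivity (\int[pushforward mu r]_(s in D) h s)%E.
  apply: eq_measure_integral => A mA _.
  by rewrite /pushforward; exact/esym/mu_ext_reflect.
have hr s : s \in D -> h (r s) = (g (u + v - s))%:E.
  by rewrite -{1}rD inE/= => sD; rewrite /h patchE mem_set.
rewrite integral_pushforward//.
- by rewrite rD; apply: eq_integral => s /hr.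
- have mg := measurable_int _ ig.
  by apply/(measurable_restrictT _ _).1 => //; exact: mD.
- rewrite rD; apply: eq_integrable irg => //.
  by move=> s /hr/esym.
Qed.

(** * Convex functions on a segment *)

(** Replaces the bundled weight of [convex_function] by a real [t] with explicit bounds, on which
    linear arithmetic can work. *)
Lemma convex_functionP (R : realType) (u v : R) (h : R -> R) :
  convex_function (`[u, v] : set R) h <->
  (forall t a b, 0 <= t <= 1 -> u <= a <= v -> u <= b <= v ->
     h (t * a + (1 - t) * b) <= t * h a + (1 - t) * h b).
Proof.
split=> [ch t a b /andP[t0 t1] ab bb|ch t a b /[!inE]/= /[!in_itv]/= ab bb].
  have t01 : (0 <= t) && (t <= 1) by rewrite t0.
  have := ch (Itv01 t0 t1) a b.
  rewrite !inE/= !in_itv/= => /(_ ab bb).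
  by [].
have := ch t%:num a b.
rewrite ge0 le1/= => /(_ isT ab bb).
by [].
Qed.

Lemma convex_function_affine (R : realType) (u v u' v' k l : R) (h : R -> R) :
  convex_function (`[u, v] : set R) h ->
  (forall s, u' <= s <= v' -> u <= k * s + l <= v) ->
  convex_function (`[u', v'] : set R) (fun s => h (k * s + l)).
Proof.
move=> /convex_functionP ch kl; apply/convex_functionP => t a b t01 ab bb.
have -> : k * (t * a + (1 - t) * b) + l = t * (k * a + l) + (1 - t) * (k * b + l) by ring.
by apply: ch => //; exact: kl.
Qed.

Lemma convex_functionD (R : realType) (u v : R) (g h : R -> R) :
  convex_function (`[u, v] : set R) g -> convex_function (`[u, v] : set R) h ->
  convex_function (`[u, v] : set R) (fun s => g s + h s).
Proof.
move=> /convex_functionP cg /convex_functionP ch; apply/convex_functionP.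
move=> t a b t01 ab bb.
by have := cg t a b t01 ab bb; have := ch t a b t01 ab bb; lra.
Qed.

Lemma convex_functionZ (R : realType) (u v k : R) (h : R -> R) : 0 <= k ->
  convex_function (`[u, v] : set R) h ->
  convex_function (`[u, v] : set R) (fun s => k * h s).
Proof.
move=> k0 /convex_functionP ch; apply/convex_functionP => t a b t01 ab bb.
by have := ler_wpM2l k0 (ch t a b t01 ab bb); lra.
Qed.

Lemma convex_function_cst (R : realType) (u v k : R) :
  convex_function (`[u, v] : set R) (fun=> k).
Proof. by apply/convex_functionP => t a b _ _ _; lra. Qed.

(** [z] and its mirror image are convex combinations of [w] and its mirror image with exchanged
    weights, so adding the two convexity inequalities gives each value of [h] on the right total
    weight 1. *)
Lemma convex_function_spread (R : realType) (u v w z : R) (h : R -> R) :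
  convex_function (`[u, v] : set R) h -> u <= w -> w <= z <= u + v - w ->
  h z + h (u + v - z) <= h w + h (u + v - w).
Proof.
move=> /convex_functionP ch uw /andP[wz zw].
(* If [w] is the midpoint, then [z = w]; otherwise the weight [t] below has a nonzero
   denominator. *)
have [ww|ww] := eqVneq w (u + v - w).
  by have -> : z = w by lra.
have w0 : 0 < u + v - w - w by rewrite subr_gt0 lt_neqAle ww; lra.
pose t := (u + v - w - z) / (u + v - w - w).
have t01 : 0 <= t <= 1 by rewrite divr_ge0 ?ler_pdivrMr//=; lra.
have tw : t * (u + v - w - w) = u + v - w - z by rewrite divfK// gt_eqF.
have ez : z = t * w + (1 - t) * (u + v - w) by lra.
have ez' : u + v - z = (1 - t) * w + (1 - (1 - t)) * (u + v - w) by lra.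
have wb : u <= w <= v by lra.
have wb' : u <= u + v - w <= v by lra.
have t'01 : 0 <= 1 - t <= 1 by lra.
have := ch t w (u + v - w) t01 wb wb'; rewrite -ez.
by have := ch (1 - t) w (u + v - w) t'01 wb wb'; rewrite -ez'; lra.
Qed.

Lemma convex_function_le_max (R : realType) (u v w : R) (h : R -> R) :
  convex_function (`[u, v] : set R) h -> u <= w <= v -> h w <= Num.max (h u) (h v).
Proof.
move=> /convex_functionP ch /andP[uw wv].
have [uv|uv] := eqVneq u v.
  by have -> : w = u; [lra|rewrite le_max lexx].
have vu : 0 < v - u by rewrite subr_gt0 lt_neqAle uv; lra.
pose t := (v - w) / (v - u).
have /andP[t0 t1] : 0 <= t <= 1 by rewrite divr_ge0 ?ler_pdivrMr//=; lra.
have tw : t * (v - u) = v - w by rewrite divfK// gt_eqF.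
have ew : w = t * u + (1 - t) * v by lra.
have := ch t u v; rewrite t0 t1 !lexx -ew (le_trans uw wv) => /(_ isT isT isT) hw.
apply: (le_trans hw).
have -> : Num.max (h u) (h v) =
  t * Num.max (h u) (h v) + (1 - t) * Num.max (h u) (h v) by ring.
by apply: lerD; apply: ler_wpM2l; rewrite ?subr_ge0// le_max lexx ?orbT.
Qed.

Lemma convex_function_sub (R : realType) (u v u' v' : R) (h : R -> R) :
  u <= u' -> v' <= v ->
  convex_function (`[u, v] : set R) h -> convex_function (`[u', v'] : set R) h.
Proof.
move=> uu vv /convex_functionP ch; apply/convex_functionP => t a b t01 ab bb.
by apply: ch => //; lra.
Qed.

(** * Boundedness, measurability and integrability from convexity *)

(** The endpoints bound [h] from above by [M]. From below, [h s] is at least twice the midpoint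
    value minus the value at the mirror image of [s], which is at most [M]. *)
Lemma convex_function_bounded (R : realType) (u v : R) (h : R -> R) :
  convex_function (`[u, v] : set R) h -> [bounded h s | s in `[u, v]%classic].
Proof.
move=> ch; pose M := `|h u| + `|h v|.
exists (M + `|2 * h ((u + v) / 2)|); split=> [|B MB s]; first exact: num_real.
have upper w : u <= w <= v -> h w <= M.
  move=> /(convex_function_le_max ch)/le_trans; apply.
  by rewrite ge_max /M; have := ler_norm (h u); have := ler_norm (h v);
     have := normr_ge0 (h u); have := normr_ge0 (h v); lra.
rewrite /= in_itv/= => sb; apply: le_trans (ltW MB).
have sb' : u <= u + v - s <= v by lra.
have up := upper _ sb; have up' := upper _ sb'.
have mid : 2 * h ((u + v) / 2) <= h s + h (u + v - s).
  have := @convex_function_spread R u v s ((u + v) / 2) h ch.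
  have := @convex_function_spread R u v (u + v - s) ((u + v) / 2) h ch.
  rewrite !subKr (_ : u + v - (u + v) / 2 = (u + v) / 2); last by lra.
  (* The spreading inequality needs its outer point in the left half: this is [s] or its mirror
     image. *)
  have [ss|ss] := leP s (u + v - s).
    by move=> _ /(_ ltac:(lra) ltac:(lra)); lra.
  by move=> /(_ ltac:(lra) ltac:(lra)) + _; lra.
have M0 := normr_ge0 (2 * h ((u + v) / 2)).
have := ler_norm (- (2 * h ((u + v) / 2))); rewrite normrN => M1.
by rewrite ler_norml; lra.
Qed.

(* The strict sublevel sets of a convex function are intervals. *)
Lemma convex_function_measurable (R : realType) (u v : R) (h : R -> R) :
  convex_function (`[u, v] : set R) h ->
  measurable_fun (`[u, v]%classic : set (measurableTypeR R)) (h : _ -> measurableTypeR R).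
Proof.
move=> ch mD.
apply: (measurability _ (RGenInftyO.measurableE R)) => // _ [_ [r ->] <-].
apply: is_interval_measurable => a b /=.
rewrite !in_itv/= => -[/andP[ua av] har] [/andP[ub bv] hbr] w /andP[aw wb].
have hw := convex_function_le_max (convex_function_sub ua bv ch) (introT andP (conj aw wb)).
rewrite !in_itv/= (le_trans ua aw) (le_trans wb bv); split => //.
by rewrite (le_lt_trans hw)// gt_max har.
Qed.

(** A bounded measurable factor preserves integrability; Borel measurability of [h] passes to the
    larger Lebesgue sigma-algebra. *)
Lemma integrable_convexM (R : realType) (u v : R) (h p : R -> R) :
  convex_function (`[u, v] : set R) h -> itv_integrable u v p ->
  itv_integrable u v (fun s => h s * p s).
Proof.
move=> ch ip; rewrite /itv_integrable.
pose T := caratheodory_type (@wlength R idfun)^*%mu.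
pose D : set T := `[u, v]%classic.
have mD : measurable D by apply: sub_caratheodory; exact: measurable_itv.
have mh : measurable_fun D (h : T -> measurableTypeR R).
  move=> _ A mA; apply: sub_caratheodory.
  exact: (convex_function_measurable ch (measurable_itv _) mA).
have := integrableMr mD mh (convex_function_bounded ch) ip.
exact: eq_integrable.
Qed.

(** * The weighted integral common to all the functionals, and its monotonicity *)

(** Taking for [phi] the function [f], a constant, or an average of [f] over segments yields every
    integral to be compared, with [Ip1] and [Ip2] entering through their mean. *)
Definition split_integral (R : realType) (p : R -> R) (alpha x x' : R) (phi : R -> R) : R :=
  itv_integral x x' (fun s => (phi ((1 - alpha) * x + alpha * s)
                               + phi ((1 - alpha) * x' + alpha * s)) * p s).

Section weighted_integral.
Context (R : realType) (x x' alpha y : R) (p : R -> R).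
Hypotheses (hxx' : x < x') (halpha : 0 < alpha <= 2^-1).
Hypothesis (hy : y = (1 - alpha) * x + alpha * x').
Hypothesis (hp0 : forall s, s \in `[x, x'] -> 0 <= p s).
Hypothesis (hpint : itv_integrable x x' p).
Hypothesis (hpsym : forall s, s \in `[x, x'] -> p s = p (x + x' - s)).
Implicit Types phi psi : R -> R.

Local Notation J := (split_integral p alpha x x').
Local Notation lo s := ((1 - alpha) * x + alpha * s).
Local Notation hi s := ((1 - alpha) * x' + alpha * s).

Let mD : measurable (`[x, x']%classic : set (caratheodory_type (@wlength R idfun)^*%mu)).
Proof. by apply: sub_caratheodory; exact: measurable_itv. Qed.

Let lo_itv s : x <= s <= x' -> x <= lo s <= y.
Proof. by move: halpha hxx'; rewrite hy => /andP[? ?] ? /andP[? ?]; apply/andP; nra. Qed.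

(** Since y - (x + x') / 2 = (alpha - 1/2) (x' - x), the bound alpha <= 1/2 puts [y] in the left
    half. *)
Let y_mid : x <= y <= (x + x') / 2.
Proof. by move: halpha hxx'; rewrite hy => /andP[? ?] ?; apply/andP; nra. Qed.

Let hi_itv s : x <= s <= x' -> x <= hi s <= x'.
Proof. by move: halpha hxx' => /andP[? ?] ? /andP[? ?]; apply/andP; nra. Qed.

Lemma lo_convex phi : convex_function (`[x, x'] : set R) phi ->
  convex_function (`[x, x'] : set R) (fun s => phi (lo s)).
Proof.
move=> cphi.
have -> : (fun s => phi (lo s)) = (fun s => phi (alpha * s + (1 - alpha) * x)).
  by apply/funext => s; rewrite addrC.
apply: convex_function_affine cphi _ => s /lo_itv.
by have := y_mid; have := hxx'; lra.
Qed.

Lemma hi_convex phi : convex_function (`[x, x'] : set R) phi ->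
  convex_function (`[x, x'] : set R) (fun s => phi (hi s)).
Proof.
move=> cphi.
have -> : (fun s => phi (hi s)) = (fun s => phi (alpha * s + (1 - alpha) * x')).
  by apply/funext => s; rewrite addrC.
by apply: convex_function_affine cphi _ => s /hi_itv; lra.
Qed.

Let reflect_convex phi : convex_function (`[x, x'] : set R) phi ->
  convex_function (`[x, x'] : set R) (fun s => phi (x + x' - s)).
Proof.
move=> cphi.
have -> : (fun s => phi (x + x' - s)) = (fun s => phi (- 1 * s + (x + x'))).
  by apply/funext => s; congr phi; ring.
by apply: convex_function_affine cphi _ => s; lra.
Qed.

Lemma split_integral_integrable phi : convex_function (`[x, x'] : set R) phi ->
  itv_integrable x x' (fun s => (phi (lo s) + phi (hi s)) * p s).
Proof.
move=> cphi; apply: (@integrable_convexM _ _ _ (fun s => phi (lo s) + phi (hi s))) => //.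
by apply: convex_functionD; [exact: lo_convex|exact: hi_convex].
Qed.

(** Convexity of [phi] and [psi] supplies the integrability behind additivity. *)
Lemma split_integral_lin phi psi k l :
  convex_function (`[x, x'] : set R) phi -> convex_function (`[x, x'] : set R) psi ->
  J (fun w => k * phi w + l * psi w) = k * J phi + l * J psi.
Proof.
move=> cphi cpsi; rewrite /split_integral /itv_integral.
have iphi := split_integral_integrable cphi; have ipsi := split_integral_integrable cpsi.
rewrite -RintegralZl// -RintegralZl// -RintegralD//.
- by apply: eq_Rintegral => s _; ring.
- by have := integrableZl mD k iphi; apply: eq_integrable.
- by have := integrableZl mD l ipsi; apply: eq_integrable.
Qed.

Lemma split_integral_cst k : J (fun=> k) = 2 * k * itv_integral x x' p.
Proof.
rewrite /split_integral /itv_integral -RintegralZl//.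
by apply: eq_Rintegral => s _; ring.
Qed.

Lemma split_integral_sym phi : convex_function (`[x, x'] : set R) phi ->
  J phi = itv_integral x x' (fun s => (phi (lo s) + phi (x + x' - lo s)) * p s).
Proof.
move=> cphi.
have ilo := integrable_convexM (lo_convex cphi) hpint.
have ihi := integrable_convexM (hi_convex cphi) hpint.
(* After reflection the [hi] summand becomes the [lo] summand of the reflected [phi], which is again
   convex. This provides the integrability that [integral_reflect] asks of the reflected
   integrand. *)
have irhi := integrable_convexM (lo_convex (reflect_convex cphi)) hpint.
transitivity (itv_integral x x' (fun s => phi (lo s) * p s)
              + itv_integral x x' (fun s => phi (hi s) * p s)).
  rewrite /split_integral /itv_integral -RintegralD//.
  by apply: eq_Rintegral => s _; ring.
have hi_refl s : s \in `[x, x']%classic -> phi (hi (x + x' - s)) * p (x + x' - s)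
    = phi (x + x' - lo s) * p s.
  rewrite inE/= => sD; rewrite -hpsym//; congr (phi _ * _); ring.
rewrite [X in _ + X]integral_reflect//; last first.
  by apply: eq_integrable irhi => //= s /hi_refl/= ->.
have -> : itv_integral x x' (fun s => phi (hi (x + x' - s)) * p (x + x' - s))
    = itv_integral x x' (fun s => phi (x + x' - lo s) * p s).
  by apply: eq_Rintegral => s; exact: hi_refl.
rewrite /itv_integral -RintegralD//.
by apply: eq_Rintegral => s _; ring.
Qed.

(** Once both sides are symmetrized, the integrands compare pointwise: [lo s] stays in [x, y] and
    the weight is nonnegative. *)
Lemma le_split_integral phi psi :
  convex_function (`[x, x'] : set R) phi -> convex_function (`[x, x'] : set R) psi ->
  (forall w, x <= w <= y ->
    phi w + phi (x + x' - w) <= psi w + psi (x + x' - w)) ->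
  J phi <= J psi.
Proof.
move=> cphi cpsi le_phi_psi; rewrite !split_integral_sym// /itv_integral.
have sym_integrable h : convex_function (`[x, x'] : set R) h ->
    itv_integrable x x' (fun s => (h (lo s) + h (x + x' - lo s)) * p s).
  move=> ch; apply: (@integrable_convexM _ _ _ (fun s => h (lo s) + h (x + x' - lo s))) => //.
  apply: convex_functionD; first exact: lo_convex.
  exact: (lo_convex (reflect_convex ch)).
apply: le_Rintegral => //; [exact: sym_integrable|exact: sym_integrable|].
move=> s /= sD; rewrite ler_wpM2r ?hp0//.
by apply: le_phi_psi; apply: lo_itv; move: sD; rewrite in_itv.
Qed.
End weighted_integral.

(** * Pointwise averages behind [Sp], [Ip1], [Ip2], and their comparison *)

Section functionals.
Context (R : realType) (x x' alpha y y' : R) (f p : R -> R).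
Hypotheses (hxx' : x < x') (halpha : 0 < alpha <= 2^-1).
Hypothesis (hy : y = (1 - alpha) * x + alpha * x').
Hypothesis (hy' : y' = alpha * x + (1 - alpha) * x').
Hypothesis (hf : convex_function (`[x, x'] : set R) f).
Hypothesis (hpint : itv_integrable x x' p).

Let y_mid : x <= y <= (x + x') / 2.
Proof. by move: halpha hxx'; rewrite hy => /andP[? ?] ?; apply/andP; nra. Qed.

Let y'E : y' = x + x' - y. Proof. by rewrite hy hy'; ring. Qed.

Lemma segment_itv t v w : 0 <= t <= 1 -> x <= v <= x' -> x <= w <= x' ->
  x <= t * v + (1 - t) * w <= x'.
Proof.
move=> /andP[t0 t1] /andP[xv vx'] /andP[xw wx']; have t'0 : 0 <= 1 - t by lra.
have := ler_wpM2l t0 xv; have := ler_wpM2l t0 vx'.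
by have := ler_wpM2l t'0 xw; have := ler_wpM2l t'0 wx'; lra.
Qed.

Lemma segment_convexl t w : 0 <= t <= 1 -> x <= w <= x' ->
  convex_function (`[x, x'] : set R) (fun v => f (t * v + (1 - t) * w)).
Proof.
by move=> t01 wb; apply: convex_function_affine hf _ => s sb; exact: segment_itv.
Qed.

Lemma segment_convexr t v : 0 <= t <= 1 -> x <= v <= x' ->
  convex_function (`[x, x'] : set R) (fun w => f (t * v + (1 - t) * w)).
Proof.
move=> t01 vb.
have -> : (fun w => f (t * v + (1 - t) * w)) = (fun w => f ((1 - t) * w + t * v)).
  by apply/funext => w; rewrite addrC.
by apply: convex_function_affine hf _ => s sb; rewrite addrC; exact: segment_itv.
Qed.

(** The variable [w] carries weight 1 - t here but weight t in [inner_avg], which is why the direct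
    comparison of the two exchanges t and 1 - t. *)
Definition endpoint_avg t w : R :=
  2^-1 * (f (t * x + (1 - t) * w) + f (t * x' + (1 - t) * w)).

Definition inner_avg t w : R :=
  2^-1 * (f (t * w + (1 - t) * y) + f (t * w + (1 - t) * y')).

Lemma endpoint_avg_convex t : 0 <= t <= 1 ->
  convex_function (`[x, x'] : set R) (endpoint_avg t).
Proof.
have xx' := hxx';
move=> t01; apply: convex_functionZ; first by rewrite invr_ge0.
by apply: convex_functionD; apply: segment_convexr => //; lra.
Qed.

Lemma inner_avg_convex t : 0 <= t <= 1 ->
  convex_function (`[x, x'] : set R) (inner_avg t).
Proof.
have xx' := hxx'; have ym := y_mid.
move=> t01; apply: convex_functionZ; first by rewrite invr_ge0.
by apply: convex_functionD; apply: segment_convexl => //; rewrite ?y'E; lra.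
Qed.

Lemma SpE t : Sp f p alpha x x' t = split_integral p alpha x x' (endpoint_avg t).
Proof.
by apply: eq_Rintegral => s _; rewrite /endpoint_avg; ring.
Qed.

(** [Ip1] and [Ip2] pair the two inner points with [y] and [y'] in the two possible ways; together
    they contain all four combinations. *)
Lemma IpE t : 0 <= t <= 1 ->
  (Ip1 f p alpha x x' y y' t + Ip2 f p alpha x x' y y' t) / 2
  = split_integral p alpha x x' (inner_avg t).
Proof.
have xx' := hxx'; have ym := y_mid.
move=> t01.
have yb : x <= y <= x' by lra.
have y'b : x <= y' <= x' by rewrite y'E; lra.
have mixed_integrable v w : x <= v <= x' -> x <= w <= x' -> itv_integrable x x' (fun s =>
    (f (t * ((1 - alpha) * x + alpha * s) + (1 - t) * v)
     + f (t * ((1 - alpha) * x' + alpha * s) + (1 - t) * w)) * p s).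
  move=> vb wb.
  apply: (@integrable_convexM _ _ _ (fun s =>
    f (t * ((1 - alpha) * x + alpha * s) + (1 - t) * v)
     + f (t * ((1 - alpha) * x' + alpha * s) + (1 - t) * w))) => //.
  apply: convex_functionD.
    exact: (lo_convex hxx' halpha hy (segment_convexl t01 vb)).
  exact: (hi_convex hxx' halpha (segment_convexl t01 wb)).
have i1 := mixed_integrable _ _ yb y'b; have i2 := mixed_integrable _ _ y'b yb.
have mD : measurable (`[x, x']%classic : set (caratheodory_type (@wlength R idfun)^*%mu)).
  by apply: sub_caratheodory; exact: measurable_itv.
rewrite /Ip1 /Ip2 /split_integral /itv_integral -RintegralD// -RintegralZr//.
  by apply: eq_Rintegral => s _; rewrite /inner_avg; field.
by have := integrableD mD i1 i2; apply: eq_integrable.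
Qed.

(** With [w] fixed at weight 1 - t on both sides, the other argument spreads from the pair y, y' to
    the pair x, x'. *)
Lemma inner_avg_onem_le t w : 0 <= t <= 1 -> x <= w <= x' ->
  inner_avg (1 - t) w <= endpoint_avg t w.
Proof.
have xx' := hxx'; have ym := y_mid.
move=> t01 wb; rewrite /inner_avg /endpoint_avg ler_pM2l ?invr_gt0//.
have := convex_function_spread (segment_convexl t01 wb) (lexx x) (z := y).
move=> /(_ ltac:(lra)).
rewrite (_ : x + x' - x = x') -?y'E; last by ring.
by rewrite subKr ![(1 - t) * w + _]addrC.
Qed.

Lemma inner_avg_sym_le t w : 0 <= t <= 1 -> x <= w <= y ->
  inner_avg t w + inner_avg t (x + x' - w)
  <= endpoint_avg t w + endpoint_avg t (x + x' - w).
Proof.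
have xx' := hxx'; have ym := y_mid.
move=> t01 wb; rewrite /inner_avg /endpoint_avg -!mulrDr ler_pM2l ?invr_gt0//.
have wb1 : x <= w <= x' by lra.
have wb2 : x <= x + x' - w <= x' by lra.
(* The argument of weight 1 - t spreads from y, y' to [w] and its mirror image, the other one being
   fixed at each of these two points. *)
have := convex_function_spread (segment_convexr t01 wb1) (w := w) (z := y) ltac:(lra) ltac:(lra).
have := convex_function_spread (segment_convexr t01 wb2) (w := w) (z := y) ltac:(lra) ltac:(lra).
(* The argument of weight t now spreads from [w] and its mirror image to x, x'. The four
   intermediate values cancel in the sum. *)
have := convex_function_spread (segment_convexl t01 wb1) (w := x) (z := w) ltac:(lra) ltac:(lra).
have := convex_function_spread (segment_convexl t01 wb2) (w := x) (z := w) ltac:(lra) ltac:(lra).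
rewrite /= (_ : x + x' - x = x') -?y'E; last by ring.
by lra.
Qed.

(** The left-hand side is [G1 + G2] at [t]: among the mirror pairs considered, y, y' is the
    innermost. *)
Lemma endpoint_avg_mid_le t w : 0 <= t <= 1 -> x <= w <= y ->
  endpoint_avg t y + endpoint_avg t y' <= endpoint_avg t w + endpoint_avg t (x + x' - w).
Proof.
have xx' := hxx'; have ym := y_mid.
by move=> t01 wb; rewrite y'E; apply: (convex_function_spread (endpoint_avg_convex t01)); lra.
Qed.

Lemma endpoint_avg_le t w : 0 <= t <= 1 -> x <= w <= x' ->
  endpoint_avg t w <= (1 - t) * f w + t * (2^-1 * (f x + f x')).
Proof.
have xx' := hxx';
move=> t01 wb; have /convex_functionP ch := hf.
have xb : x <= x <= x' by lra.
have x'b : x <= x' <= x' by lra.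
have := ch t x w t01 xb wb; have := ch t x' w t01 x'b wb.
by rewrite /endpoint_avg; lra.
Qed.

(** For fixed endpoints a segment point is affine in its parameter. Integration turns this into the
    convexity of [Sp]. *)
Lemma endpoint_avg_convex_param t t1 t2 w : 0 <= t <= 1 -> 0 <= t1 <= 1 -> 0 <= t2 <= 1 ->
  x <= w <= x' ->
  endpoint_avg (t * t1 + (1 - t) * t2) w <= t * endpoint_avg t1 w + (1 - t) * endpoint_avg t2 w.
Proof.
have xx' := hxx';
move=> t01 t11 t21 wb; have /convex_functionP ch := hf.
have conv v : x <= v <= x' ->
    f ((t * t1 + (1 - t) * t2) * v + (1 - (t * t1 + (1 - t) * t2)) * w)
    <= t * f (t1 * v + (1 - t1) * w) + (1 - t) * f (t2 * v + (1 - t2) * w).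
  move=> vb.
  have := ch t _ _ t01 (segment_itv t11 vb wb) (segment_itv t21 vb wb).
  by congr (f _ <= _); ring.
have := conv x ltac:(lra); have := conv x' ltac:(lra).
by rewrite /endpoint_avg; lra.
Qed.
End functionals.

(** * Integration of the pointwise comparisons, and the supremum *)

Theorem theorem19 (R : realType) (a b x x' alpha y y' m' : R) (f p : R -> R)
    (hax : a <= x) (hxx' : x < x') (hx'b : x' <= b)
    (halpha : 0 < alpha <= 2^-1)
    (hy : y = (1 - alpha) * x + alpha * x')
    (hy' : y' = alpha * x + (1 - alpha) * x')
    (hm' : m' = if y == y' then 0 else 2^-1)
    (hf : convex_function (`[a, b] : set R) f)
    (hp0 : forall s, s \in `[x, x'] -> 0 <= p s)
    (hpint : itv_integrable x x' p)
    (hpsym : forall s, s \in `[x, x'] -> p s = p (x + x' - s)) :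
  [/\ convex_function (`[0, 1] : set R) (Sp f p alpha x x'),
      (forall t, t \in `[0, 1] ->
         [/\ (G1 f x x' y y' t + G2 f x x' y y' t) * itv_integral x x' p
               <= Sp f p alpha x x' t,
             Sp f p alpha x x' t
               <= (1 - t) * itv_integral x x' (fun s =>
                     (f ((1 - alpha) * x + alpha * s)
                      + f ((1 - alpha) * x' + alpha * s)) * p s)
                  + t * (f x + f x') * itv_integral x x' p,
             (1 - t) * itv_integral x x' (fun s =>
                     (f ((1 - alpha) * x + alpha * s)
                      + f ((1 - alpha) * x' + alpha * s)) * p s)
                  + t * (f x + f x') * itv_integral x x' p
               <= (f x + f x') * itv_integral x x' p
           & (Ip1 f p alpha x x' y y' (1 - t)
              + Ip2 f p alpha x x' y y' (1 - t)) / 2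
               <= Sp f p alpha x x' t])
    & (forall t, t \in `[m', 1] ->
         (Ip1 f p alpha x x' y y' t + Ip2 f p alpha x x' y y' t
          + Ip1 f p alpha x x' y y' (1 - t)
          + Ip2 f p alpha x x' y y' (1 - t)) / 4
           <= Sp f p alpha x x' t)
      /\ sup [set Sp f p alpha x x' t | t in `[0, 1]]
           = (f x + f x') * itv_integral x x' p].
Proof.
set I := itv_integral x x' p.
have hfx : convex_function (`[x, x'] : set R) f := convex_function_sub hax hx'b hf.
pose J := split_integral p alpha x x'.
have y_mid : x <= y <= (x + x') / 2.
  by move: halpha hxx'; rewrite hy => /andP[? ?] ?; apply/andP; nra.
have leJ := le_split_integral hxx' halpha hy hp0 hpint hpsym.
have linJ := split_integral_lin hxx' halpha hy hpint.
have cstJ := split_integral_cst alpha hpint.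
have cE := endpoint_avg_convex hxx' hfx.
have cI := inner_avg_convex hxx' halpha hy hy' hfx.
have Jf_le : J f <= (f x + f x') * I.
  (* [J] sends a constant k to 2 k I, whence the factor 1/2. *)
  have -> : (f x + f x') * I = J (fun=> 2^-1 * (f x + f x')).
    by rewrite /J cstJ /I; field.
  apply: leJ => [//||w wb]; first exact: convex_function_cst.
  have := convex_function_spread hfx (w := x) (z := w) ltac:(lra) ltac:(lra).
  by rewrite (_ : x + x' - x = x'); [lra|ring].
have Sp_le t : 0 <= t <= 1 ->
    Sp f p alpha x x' t <= (1 - t) * J f + t * (f x + f x') * I.
  move=> t01; rewrite SpE.
  have -> : (1 - t) * J f + t * (f x + f x') * I =
      J (fun w => (1 - t) * f w + t * (2^-1 * (f x + f x'))).
    rewrite [RHS]linJ//; last exact: convex_function_cst.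
    by rewrite cstJ /J /I; field.
  apply: leJ; first exact: cE.
    apply: convex_functionD; last exact: convex_function_cst.
    by apply: convex_functionZ => //; lra.
  by move=> w wb; apply: lerD; apply: (endpoint_avg_le hxx' hfx t01); lra.
have bound_le t : 0 <= t <= 1 ->
    (1 - t) * J f + t * (f x + f x') * I <= (f x + f x') * I.
  by move=> /andP[t0 t1]; have := ler_wpM2l (_ : 0 <= 1 - t) Jf_le; lra.
have Ip_le t : 0 <= t <= 1 ->
    (Ip1 f p alpha x x' y y' (1 - t) + Ip2 f p alpha x x' y y' (1 - t)) / 2
    <= Sp f p alpha x x' t.
  move=> t01; have t01' : 0 <= 1 - t <= 1 by lra.
  rewrite SpE IpE//; apply: leJ; [exact: cI|exact: cE|].
  by move=> w wb; apply: lerD;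
     apply: (inner_avg_onem_le hxx' halpha hy hy' hfx t01); lra.
split.
- apply/convex_functionP => t t1 t2 t01 t11 t21.
  rewrite !SpE -linJ; try exact: cE.
  apply: leJ; first exact/cE/segment_itv.
    by apply: convex_functionD; apply: convex_functionZ; first [exact: cE | lra].
  by move=> w wb; apply: lerD;
    apply: (endpoint_avg_convex_param hxx' hfx t01 t11 t21); lra.
- move=> t; rewrite in_itv/= => t01; split.
  + rewrite SpE.
    have -> : (G1 f x x' y y' t + G2 f x x' y y' t) * itv_integral x x' p
        = J (fun=> 2^-1 * (endpoint_avg x x' f t y + endpoint_avg x x' f t y')).
      by rewrite /J cstJ /G1 /G2 /endpoint_avg; field.
    apply: leJ; [exact: convex_function_cst|exact: cE|] => w wb.
    have := endpoint_avg_mid_le hxx' halpha hy hy' hfx t01 wb.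
    lra.
  + exact: Sp_le.
  + exact: bound_le.
  + exact: Ip_le.
- split.
  + move=> t; rewrite in_itv/= => /andP[mt t1].
    (* Either value of [m'] is nonnegative, so [t] lies in [0, 1]. The claim is then the mean of
       [Ip_le] and the bound for the parameter [t] itself. *)
    have t01 : 0 <= t <= 1.
      by rewrite t1 andbT (le_trans _ mt)// hm'; case: ifP; rewrite ?invr_ge0.
    have : (Ip1 f p alpha x x' y y' t + Ip2 f p alpha x x' y y' t) / 2
        <= Sp f p alpha x x' t.
      rewrite SpE IpE//; apply: leJ; [exact: cI|exact: cE|].
      by move=> w; exact: (inner_avg_sym_le hxx' halpha hy hy' hfx t01).
    by have := Ip_le t t01; lra.
  (* The supremum is attained at t = 1, where [endpoint_avg] no longer depends on [w]. *)
  + have Sp1 : Sp f p alpha x x' 1 = (f x + f x') * I.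
      rewrite SpE.
      have -> : endpoint_avg x x' f 1 = fun=> 2^-1 * (f x + f x').
        by apply/funext => w; rewrite /endpoint_avg !mul1r subrr !mul0r !addr0.
      by rewrite cstJ /I; field.
    have ubS : ubound [set Sp f p alpha x x' t | t in `[0, 1]] ((f x + f x') * I).
      move=> _ [t + <-]; rewrite /= in_itv/= => t01.
      exact: le_trans (Sp_le t t01) (bound_le t t01).
    apply/eqP; rewrite eq_le; apply/andP; split.
      (* [sup] is a least upper bound only for nonempty sets bounded above: the value at 1 gives
         nonemptiness here, and [ubS] gives the bound for the converse inequality. *)
      apply: ge_sup => //.
      by exists (Sp f p alpha x x' 1), 1 => //=; rewrite in_itv/= ler01 lexx.
    rewrite -Sp1; apply: ub_le_sup; first by exists ((f x + f x') * I).
    by exists 1 => //=; rewrite in_itv/= ler01 lexx.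
Qed.
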